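(* Let $K\subseteq\mathbb{R}^n$ be a Euclidean cubical complex with initial vertex $\mathbf{0}$, and suppose there is a finite sequence of directed collapses from $K$ to $K'$, i.e. Euclidean cubical complexes $K=K^{(0)},K^{(1)},\dots,K^{(m)}=K'$ such that $K^{(i+1)}$ is a directed collapse of $K^{(i)}$ for each $0\le i<m$. Then there are no past link obstructions in $K$ with respect to $\mathbf{0}$ if and only if there are no past link obstructions in $K'$ with respect to $\mathbf{0}$. This holds both for obstructions of type-$\infty$ and for obstructions of type-$0$.
   Context: For $\mathbf{p},\mathbf{q}\in\mathbb{R}^n$ write $\mathbf{p}\preceq\mathbf{q}$ if $p_i\le q_i$ for all $i$, and $[\mathbf{p},\mathbf{q}]=\{\mathbf{x}\in\mathbb{R}^n:\mathbf{p}\preceq\mathbf{x}\preceq\mathbf{q}\}$. If $\mathbf{p},\mathbf{q}\in\mathbb{Z}^n$ and $\mathbf{q}-\mathbf{p}\in\{0,1\}^n$, then $[\mathbf{p},\mathbf{q}]$ is an elementary cube. A Euclidean cubical complex $K\subseteq\mathbb{R}^n$ is a union of elementary cubes; it is identified with the associated abstract cubical complex, i.e. the collection of all elementary cubes contained in it. Its vertex set $K_0$ is the set of integer points (elementary $0$-cubes) in $K$. Let $\Delta^{n-1}$ be the full simplicial complex on the vertex set $\{1,\dots,n\}$; a simplex $S\subseteq\{1,\dots,n\}$ is identified with its indicator vector $\mathbf{j}\in\{0,1\}^n$ ($\mathbf{j}=\mathbf{0}$ corresponds to the empty simplex). The past link $lk^-_{K,\mathbf{w}}(\mathbf{v})$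 of a vertex $\mathbf{v}$ with respect to a vertex $\mathbf{w}$ is the simplicial subcomplex of $\Delta^{n-1}$ given by: $\mathbf{j}\in lk^-_{K,\mathbf{w}}(\mathbf{v})$ if and only if $[\mathbf{v}-\mathbf{j},\mathbf{v}]\subseteq K\cap[\mathbf{w},\mathbf{v}]$. Write $lk^-_K(\mathbf{v})=lk^-_{K,\mathbf{0}}(\mathbf{v})$. Topological properties refer to geometric realizations. Directed collapse: let $K$ be a Euclidean cubical complex with initial vertex $\mathbf{0}$, and let $\sigma,\tau\in K$ be elementary cubes such that $\tau\subsetneq\sigma$, $\sigma$ is maximal (not properly contained in another cube of $K$), and no other maximal cube of $K$ contains $\tau$. Let $K'=K\setminus\{\gamma\in K:\tau\subseteq\gamma\subseteq\sigma\}$ (as a collection of cubes). Then $K'$ is a directed collapse of $K$ if for all $\mathbf{v}\in K'_0$ the past link $lk^-_K(\mathbf{v})$ is homotopy equivalent to $lk^-_{K'}(\mathbf{v})$. Past link obstructions: a vertex $\mathbf{v}\in K_0$ is a past link obstruction of type-$\infty$ (resp. type-$0$) in $K$ with respect to $\mathbf{w}$ if $lk^-_{K,\mathbf{w}}(\mathbf{v})$ is nonempty and not contractible (resp. not connected, the empty space being regarded as connected). *)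

(* Defs.v *)
From mathcomp Require Import all_boot all_order all_algebra.
From mathcomp Require Import all_classical all_reals all_analysis.

Set Implicit Arguments.
Unset Strict Implicit.
Unset Printing Implicit Defensive.

Import Order.TTheory GRing.Theory Num.Theory.
Import numFieldNormedType.Exports.

Local Open Scope classical_set_scope.
Local Open Scope ring_scope.

(* Spaces are subsets of an ambient topological space, with the subspace
   topology. A map between A `<=` T and B `<=` U is a total function T -> U of
   which only the restriction to A matters. *)
Section Homotopy.
Variable R : realType.

Definition cts_map (T U : topologicalType) (A : set T) (B : set U)
    (f : T -> U) : Prop :=
  {within A, continuous f} /\ (forall x, A x -> B (f x)).

Definition homotopic (T U : topologicalType) (A : set T) (B : set U)
    (f g : T -> U) : Prop :=
  exists H : R * T -> U,
    [/\ @cts_map (R * T)%type U (`[0, 1] `*` A) B H,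
        forall x, A x -> H (0, x) = f x
      & forall x, A x -> H (1, x) = g x].

Definition homotopy_equivalent (T U : topologicalType) (A : set T) (B : set U)
    : Prop :=
  exists (f : T -> U) (g : U -> T),
    [/\ cts_map A B f, cts_map B A g,
        homotopic A A (g \o f) id
      & homotopic B B (f \o g) id].

(* The empty space is not contractible. *)
Definition contractible (T : topologicalType) (A : set T) : Prop :=
  exists2 a, A a & homotopic A A id (cst a).

End Homotopy.

Section Cubical.
Variables (R : realType) (n : nat).
Implicit Types (p q v w x : 'rV[R]_n) (K : set 'rV[R]_n).

Definition preceq p q : Prop := forall i, p 0 i <= q 0 i.

Definition box p q : set 'rV[R]_n := [set x | preceq p x /\ preceq x q].

Definition integral_point v : Prop := forall i, v 0 i \is a Num.int.

Definition elementary_cube : set (set 'rV[R]_n) :=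
  [set s | exists p q,
    [/\ integral_point p, integral_point q,
        forall i, (q - p) 0 i = 0 \/ (q - p) 0 i = 1
      & s = box p q]].

Definition euclidean_cubical_complex K : Prop :=
  exists2 C : set (set 'rV[R]_n),
    C `<=` elementary_cube & K = \bigcup_(s in C) s.

(* The abstract cubical complex with which K is identified. *)
Definition cubes K : set (set 'rV[R]_n) :=
  [set s | elementary_cube s /\ s `<=` K].

Definition vertices K : set 'rV[R]_n :=
  [set v | integral_point v /\ K v].

Definition maximal_cube K (s : set 'rV[R]_n) : Prop :=
  cubes K s /\ forall s', cubes K s' -> ~ s `<` s'.

Definition indicator (S : {set 'I_n}) : 'rV[R]_n := \row_i (i \in S)%:R.

(* A simplicial complex on the vertices 'I_n is given by its set of simplices,
   possibly including the empty one. *)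
Definition past_link K w v : set {set 'I_n} :=
  [set S | box (v - indicator S) v `<=` K `&` box w v].

Lemma past_link_face K w v (S S' : {set 'I_n}) :
  S' \subset S -> past_link K w v S -> past_link K w v S'.
Proof.
move=> /fintype.subsetP S'S lkS; apply: subset_trans lkS => x [xl xu].
split=> // i; apply: le_trans (xl i); rewrite !mxE lerD2l lerN2 ler_nat.
by case: (boolP (i \in S')) => // /S'S ->.
Qed.

(* Points in barycentric coordinates, the support being a simplex; the empty
   simplex contributes no point. *)
Definition realization (X : set {set 'I_n}) : set 'rV[R]_n :=
  [set x | [/\ forall i, 0 <= x 0 i,
               \sum_i x 0 i = 1
             & X [set i | x 0 i != 0]%SET]].

Definition directed_collapse K K' : Prop :=
  [/\ euclidean_cubical_complex K, vertices K 0,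
      euclidean_cubical_complex K',
      exists s t : set 'rV[R]_n,
        [/\ cubes K s /\ cubes K t,
            t `<` s,
            maximal_cube K s,
            forall s', maximal_cube K s' -> t `<=` s' -> s' = s
          & cubes K' = cubes K `\` [set c | t `<=` c /\ c `<=` s]]
    & forall v, vertices K' v ->
        homotopy_equivalent R (realization (past_link K 0 v))
                              (realization (past_link K' 0 v))].

Definition obstruction_infty K w v : Prop :=
  [/\ vertices K v, realization (past_link K w v) !=set0
    & ~ contractible R (realization (past_link K w v))].

(* [connected set0] holds. *)
Definition obstruction_zero K w v : Prop :=
  vertices K v /\ ~ connected (realization (past_link K w v)).

End Cubical.

(* Main.v *)
(* It suffices to treat one directed collapse of K to K'. At a vertex of K' the
   two past links are homotopy equivalent, and contractibility and connectedness
   are homotopy invariants. A vertex v of K that is removed must be the free face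
   itself, so every cube of K containing v is a face of the single maximal cube;
   the past link of v is then a full simplex or has no points, and v is not an
   obstruction. *)

Require Import Defs.
From mathcomp Require Import all_boot all_order all_algebra.
From mathcomp Require Import all_classical all_reals all_analysis.
From mathcomp Require Import lra.

Set Implicit Arguments.
Unset Strict Implicit.
Unset Printing Implicit Defensive.

Import Order.TTheory GRing.Theory Num.Theory.
Import numFieldNormedType.Exports.

Local Open Scope classical_set_scope.
Local Open Scope ring_scope.

(** * Continuous maps and homotopies between subsets *)

Section HomotopyTheory.
Variable R : realType.
Implicit Types T U V : topologicalType.

Lemma cts_mapP T U (A : set T) (B : set U) (f : T -> U) :
  cts_map A B f <->
  forall x, A x -> B (f x) /\ f @ within A (nbhs x) --> f x.
Proof.
split=> [[/subspace_continuousP fc fAB] x Ax|h]; first by split; auto.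
split; last by move=> x /h[].
by apply/subspace_continuousP => x /h[].
Qed.

Lemma cts_map_comp T U V (A : set T) (B : set U) (C : set V) f g :
  cts_map A B f -> cts_map B C g -> cts_map A C (g \o f).
Proof.
move=> /cts_mapP fAB /cts_mapP gBC; apply/cts_mapP => x Ax.
have [Bfx fx] := fAB x Ax; have [Cgfx gfx] := gBC _ Bfx.
split=> // W /gfx Wgfx; have /fx := Wgfx; rewrite /= /within /=.
rewrite /nbhs /= /within /= /nbhs /=.
(* For [y] in [A] near [x], the point [f y] is in [B], which discharges the restriction to [B] in
   the filter at [f x]. *)
by apply: filter_app; near=> y => + Ay; apply=> //; have [] := fAB y Ay.
Unshelve. all: by end_near. Qed.

Lemma continuous_cts_map T U (A : set T) (B : set U) f :
  continuous f -> (forall x, A x -> B (f x)) -> cts_map A B f.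
Proof. by move=> fc fAB; split=> //; exact: continuous_subspaceT. Qed.

Lemma cts_map_cst T U (A : set T) (B : set U) b : B b -> cts_map A B (cst b).
Proof. by move=> Bb; apply: continuous_cts_map => // x; exact: cvg_cst. Qed.

Lemma cts_map_pair T U V (A : set T) (B : set U) (C : set V) f g :
  cts_map A B f -> cts_map A C g -> cts_map A (B `*` C) (fun x => (f x, g x)).
Proof.
move=> /cts_mapP fAB /cts_mapP gAC; apply/cts_mapP => x Ax.
have [? ?] := fAB x Ax; have [? ?] := gAC x Ax.
by split=> //; exact: cvg_pair.
Qed.

Lemma cts_map_fst T U (A : set T) (B : set U) : cts_map (A `*` B) A fst.
Proof. by apply: continuous_cts_map => [x|x []//]; exact: cvg_fst. Qed.

Lemma cts_map_snd T U (A : set T) (B : set U) : cts_map (A `*` B) B snd.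
Proof. by apply: continuous_cts_map => [x|x []//]; exact: cvg_snd. Qed.

Lemma cts_map_prodl T U V (A : set T) (B : set U) (C : set V) f :
  cts_map A B f -> cts_map (A `*` C) (B `*` C) (fun p => (f p.1, p.2)).
Proof.
move=> fAB; apply: (@cts_map_pair _ _ _ _ _ _ (f \o fst) snd);
  last exact: cts_map_snd.
exact: cts_map_comp (@cts_map_fst _ _ _ _) fAB.
Qed.

Lemma cts_map_prodr T U V (A : set T) (B : set U) (C : set V) f :
  cts_map A B f -> cts_map (C `*` A) (C `*` B) (fun p => (p.1, f p.2)).
Proof.
move=> fAB; apply: (@cts_map_pair _ _ _ _ _ _ fst (f \o snd));
  first exact: cts_map_fst.
exact: cts_map_comp (@cts_map_snd _ _ _ _) fAB.
Qed.

(** Off the level set [c x = a], continuity of [c] makes a single branch apply near [x]. Both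
    branches are continuous on all of [A], so no closed cover is involved. *)
Lemma cts_map_glue T U (A : set T) (B : set U) (c : T -> R) (a : R) f g :
  continuous c -> (forall x, A x -> c x = a -> f x = g x) ->
  cts_map A B f -> cts_map A B g ->
  cts_map A B (fun x => if c x <= a then f x else g x).
Proof.
move=> cc fg /cts_mapP fAB /cts_mapP gAB; apply/cts_mapP => x Ax.
have [? fx] := fAB x Ax; have [? gx] := gAB x Ax.
split; first by case: ifP.
have [cxa|cxa|cxa] := ltgtP (c x) a.
- apply: cvg_trans fx; apply: near_eq_cvg; rewrite near_withinE.
  near=> y => _; rewrite ltW //; near: y.
  exact: (cc x _ (lt_nbhsl cxa)).
- apply: cvg_trans gx; apply: near_eq_cvg; rewrite near_withinE.
  near=> y => _; rewrite leNgt (_ : a < c y) //; near: y.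
  exact: (cc x _ (lt_nbhsr cxa)).
(* On the level set the two limits coincide, so a point near [x] lands in [W] whichever branch it
   takes. *)
- move=> W Wfx; have Wgx : nbhs (g x) W by rewrite -fg.
  apply: (@filterS _ (within A (nbhs x)) _ (f @^-1` W `&` g @^-1` W)).
    by move=> y [? ?] /=; case: ifP.
  by apply: filterI; [exact: fx|exact: gx].
Unshelve. all: by end_near. Qed.

Lemma homotopic_sym T U (A : set T) (B : set U) f g :
  homotopic R A B f g -> homotopic R A B g f.
Proof.
move=> [H [Hc H0 H1]]; exists (H \o fun p : R * T => (1 - p.1, p.2)).
split=> [|x Ax|x Ax] /=; rewrite ?subr0 ?subrr; [|exact: H1|exact: H0].
apply: cts_map_comp Hc.
apply: (@cts_map_prodl _ _ _ _ _ _ (fun t : R => 1 - t)).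
apply: continuous_cts_map => t.
  by apply: cvgB; [exact: cvg_cst|exact: cvg_id].
by rewrite /= !in_itv /=; lra.
Qed.

Lemma homotopic_trans T U (A : set T) (B : set U) f g h :
  homotopic R A B f g -> homotopic R A B g h -> homotopic R A B f h.
Proof.
move=> [H [Hc H0 H1]] [G [Gc G0 G1]].
(* The doubled time is clamped so that both branches are defined over the whole of [[0, 1]], as the
   gluing lemma requires. At time 1/2, [l] is 1 and [r] is 0, where both homotopies give the middle
   map [g]. *)
pose l (t : R) : R := Num.min (2 * t) 1.
pose r (t : R) : R := Num.max (2 * t - 1) 0.
have dblc : continuous (fun t : R => 2 * t) by exact: mulrl_continuous.
have lc : continuous l.
  by move=> t; apply: continuous_min; [exact: dblc|exact: cvg_cst].
have rc : continuous r.
  move=> t; have mc := @continuous_max R R (fun t => 2 * t - 1) (cst 0) t.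
  apply: mc; last exact: cvg_cst.
  by apply: cvgB; [exact: dblc|exact: cvg_cst].
exists (fun p => if p.1 <= 2^-1 then H (l p.1, p.2) else G (r p.1, p.2)).
split=> [|x Ax|x Ax] /=; last 2 first.
- by rewrite ifT ?invr_ge0 // /l mulr0 min_l ?H0.
- by rewrite ifF /r;
    [rewrite max_l ?mulr1; [rewrite -G1//; congr (G (_, _))|]|]; lra.
apply: (@cts_map_glue _ _ _ _ fst 2^-1 (fun p => H (l p.1, p.2))
  (fun p => G (r p.1, p.2))).
- by move=> p; exact: cvg_fst.
- move=> [t x] [/= _ Ax] ->.
  by rewrite /l /r mulfV // minxx subrr maxxx H1 // G0.
- apply: (@cts_map_comp _ _ _ _ _ _ (fun p => (l p.1, p.2)) _ _ Hc).
  apply: cts_map_prodl; apply: continuous_cts_map => // t.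
  rewrite /= !in_itv /= /l => /andP[t0 t1].
  by rewrite le_min ge_min lexx orbT; lra.
- apply: (@cts_map_comp _ _ _ _ _ _ (fun p => (r p.1, p.2)) _ _ Gc).
  apply: cts_map_prodl; apply: continuous_cts_map => // t.
  rewrite /= !in_itv /= /r => /andP[t0 t1].
  by rewrite le_max ge_max lexx orbT; lra.
Qed.

Lemma homotopic_compl T U V (A : set T) (B : set U) (C : set V) f g h :
  homotopic R A B f g -> cts_map B C h -> homotopic R A C (h \o f) (h \o g).
Proof.
move=> [H [Hc H0 H1]] hc; exists (h \o H); split=> [|x Ax|x Ax].
- exact: cts_map_comp Hc hc.
- by rewrite /= H0.
- by rewrite /= H1.
Qed.

Lemma homotopic_compr T U V (A : set T) (B : set U) (C : set V) f g h :
  cts_map A B h -> homotopic R B C f g -> homotopic R A C (f \o h) (g \o h).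
Proof.
move=> hc [H [Hc H0 H1]]; exists (H \o fun p => (p.1, h p.2)).
have [_ hAB] := hc; split=> [|x /hAB Bhx|x /hAB Bhx] /=; [|exact: H0|exact: H1].
by apply: cts_map_comp Hc; exact: cts_map_prodr.
Qed.

(** * Homotopy invariance of nonemptiness, contractibility and connectedness *)

Lemma homotopy_equivalent_sym T U (A : set T) (B : set U) :
  homotopy_equivalent R A B -> homotopy_equivalent R B A.
Proof. by move=> [f [g [fc gc gf fg]]]; exists g, f. Qed.

Lemma homotopy_equivalent_nonempty T U (A : set T) (B : set U) :
  homotopy_equivalent R A B -> A !=set0 -> B !=set0.
Proof. by move=> [f [_ [[_ fAB] _ _ _]]] [x /fAB Bfx]; exists (f x). Qed.

Lemma homotopy_equivalent_contractible T U (A : set T) (B : set U) :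
  homotopy_equivalent R A B -> contractible R A -> contractible R B.
Proof.
move=> [f [g [fc gc _ /homotopic_sym fg]]] [a Aa idA]; exists (f a).
  exact: fc.2.
(* The identity of [B] deforms to [f \o g], and contracting [A] between [g] and [f] deforms this to
   the constant [f a]. *)
apply: homotopic_trans fg _.
exact: homotopic_compr gc (homotopic_compl idA fc).
Qed.

(* Each point of [A] is joined to [C] by its track under the homotopy. *)
Lemma connected_deformation T (A C : set T) (h : T -> T) :
  homotopic R A A id h -> (forall x, A x -> C (h x)) -> C `<=` A ->
  connected C -> connected A.
Proof.
move=> [H [Hc H0 H1]] hAC CA Cc.
have [->|/set0P[a Aa]] := eqVneq A set0; first exact: connected0.
pose track x := (fun t : R => H (t, x)) @` `[0, 1].
have trackA x : A x -> track x `<=` A.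
  by move=> Ax _ [t t01 <-]; apply: Hc.2.
have track0 x : A x -> track x x.
  by move=> Ax; exists 0; rewrite ?H0//= in_itv /= lexx ler01.
have track1 x : A x -> track x (h x).
  by move=> Ax; exists 1; rewrite ?H1//= in_itv /= lexx ler01.
have -> : A = \bigcup_(x in A) (C `|` track x).
  rewrite eqEsubset; split=> [x Ax|x [y Ay [/CA//|/trackA]]]; last exact.
  by exists x => //; right; exact: track0.
apply: bigcup_connected => [|x Ax].
  by exists (h a) => y _; left; exact: hAC.
apply: connectedU => //.
  by exists (h x); split; [exact: hAC|exact: track1].
apply: connected_continuous_connected; first exact: segment_connected.
have xc : @cts_map R (R * T)%type `[0, 1] (`[0, 1] `*` A) (fun t : R => (t, x)).
  apply: (@cts_map_pair _ _ _ _ _ _ id (cst x)); last exact: cts_map_cst.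
  by apply: continuous_cts_map => // t; exact: cvg_id.
by have [] := cts_map_comp xc Hc.
Qed.

Lemma homotopy_equivalent_connected T U (A : set T) (B : set U) :
  homotopy_equivalent R A B -> connected A -> connected B.
Proof.
move=> [f [g [fc gc _ /homotopic_sym fg]]] Ac.
apply: (connected_deformation fg (C := f @` A)).
- by move=> y /gc.2 Agy; exists (g y).
- by move=> _ [x /fc.2 ? <-].
- exact: connected_continuous_connected Ac fc.1.
Qed.

Lemma contractible_connected T (A : set T) : contractible R A -> connected A.
Proof.
move=> [a Aa idA]; apply: (connected_deformation idA (C := [set a])) => //.
  by move=> _ ->.
exact: connected1.
Qed.

(** The straight-line homotopy to a chosen point stays in [A]. *)
Lemma convex_contractible (V : normedModType R) (A : set V) :
  (forall x y t, A x -> A y -> 0 <= t <= 1 -> A ((1 - t) *: x + t *: y)) ->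
  A !=set0 -> contractible R A.
Proof.
move=> convA [a Aa]; exists a => //.
exists (fun p : R * V => (1 - p.1) *: p.2 + p.1 *: a).
split=> [|x Ax|x Ax]; rewrite ?subr0 ?subrr ?scale1r ?scale0r ?addr0 ?add0r //.
apply: continuous_cts_map => [p|[t x] /= [t01 Ax]]; last first.
  by apply: convA; rewrite //= in_itv in t01.
apply: cvgD.
  apply: cvgZ; last exact: cvg_snd.
  by apply: cvgB; [exact: cvg_cst|exact: cvg_fst].
by apply: cvgZ; [exact: cvg_fst|exact: cvg_cst].
Qed.

End HomotopyTheory.

(** * Boxes, elementary cubes and maximal cubes *)

Section PastLinks.
Variables (R : realType) (n : nat).
Implicit Types (p q v w x : 'rV[R]_n) (K : set 'rV[R]_n).

Lemma preceq_refl p : preceq p p.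
Proof. by move=> i. Qed.

Lemma preceq_trans q p x : preceq p q -> preceq q x -> preceq p x.
Proof. by move=> pq qx i; exact: le_trans (pq i) (qx i). Qed.

Lemma box_subset p q p' q' :
  preceq p' p -> preceq q q' -> box p q `<=` box p' q'.
Proof.
move=> pp qq x [px xq]; split; first exact: preceq_trans pp px.
exact: preceq_trans xq qq.
Qed.

Lemma box1 v : box v v = [set v].
Proof.
rewrite eqEsubset; split=> [x [vx xv]|_ ->]; last by split; exact: preceq_refl.
by apply/rowP => i; apply/le_anti; rewrite xv vx.
Qed.

Lemma elementary_cube1 v : integral_point v -> elementary_cube [set v].
Proof.
move=> vZ; exists v, v; split=> //; last by rewrite box1.
by move=> i; left; rewrite subrr mxE.
Qed.

Lemma unit_preceq p q :
  (forall i, (q - p) 0 i = 0 \/ (q - p) 0 i = 1) -> preceq p q.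
Proof. by move=> pq i; have := pq i; rewrite !mxE => -[]; lra. Qed.

(** For an elementary cube this is its dimension, the measure for the search of a maximal cube. *)
Definition box_dim p q := #|[set i | p 0 i != q 0 i]%SET|.

(** The inclusion, tested at the corners [p] and [q], nests the boxes coordinatewise, so every unit
    direction of the smaller cube is one of the larger. If there were no further direction, the
    cubes would coincide. *)
Lemma box_dim_lt p q p' q' :
  (forall i, (q - p) 0 i = 0 \/ (q - p) 0 i = 1) ->
  (forall i, (q' - p') 0 i = 0 \/ (q' - p') 0 i = 1) ->
  box p q `<` box p' q' -> (box_dim p q < box_dim p' q')%N.
Proof.
move=> pq pq' [sub nsub].
have p'p : preceq p' p.
  by have [] := sub p (conj (@preceq_refl _) (unit_preceq pq)).
have qq' : preceq q q'.
  by have [] := sub q (conj (unit_preceq pq) (@preceq_refl _)).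
apply: proper_card; rewrite properE; apply/andP; split.
  apply/fintype.subsetP => i; rewrite !inE => /eqP pqi; apply/eqP.
  have := pq i; have := p'p i; have := qq' i; rewrite !mxE => ? ? [] ? ?;
    apply: pqi; lra.
apply/negP => /fintype.subsetP dimE; apply: nsub.
(* In each coordinate the two nested intervals now have the same length, 0 or 1, hence the same
   endpoints. *)
have eqs i : p 0 i = p' 0 i /\ q 0 i = q' 0 i.
  have := p'p i; have := qq' i; have := dimE i; rewrite !inE.
  have := pq i; have := pq' i; rewrite !mxE.
  have [e|ne] := eqVneq (p 0 i) (q 0 i);
    have [e'|ne'] := eqVneq (p' 0 i) (q' 0 i).
  - by move=> _ _ _ ? ?; split; lra.
  - by move=> _ _ /(_ isT).
  - move=> _ [] ? _ ? ?; last by exfalso; lra.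
    by case/eqP: ne; lra.
  - move=> [] ?; first by case/eqP: ne'; lra.
    move=> [] ?; first by case/eqP: ne; lra.
    by move=> _ ? ?; split; lra.
by apply: box_subset => i; have [pi qi] := eqs i; rewrite ?pi ?qi.
Qed.

(** A cube that is not maximal lies in one of larger dimension, and dimensions are at most [n]. The
    induction is on a bound for the codimension, since [K] may have infinitely many cubes. *)
Lemma sub_maximal_cube K s :
  cubes K s -> exists2 s', maximal_cube K s' & s `<=` s'.
Proof.
suff maxk k : forall p q, (n - box_dim p q <= k)%N ->
    (forall i, (q - p) 0 i = 0 \/ (q - p) 0 i = 1) -> cubes K (box p q) ->
    exists2 s', maximal_cube K s' & box p q `<=` s'.
  move=> Ks; have [[p [q [_ _ pq sE]]] _] := Ks.
  by rewrite sE in Ks *; exact: maxk (leqnn _) pq Ks.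
elim: k => [|k IHk] p q dimk pq Kpq;
  have [[s' Ks' lts']|maxpq] :=
    pselect (exists2 s', cubes K s' & box p q `<` s');
  try by exists (box p q) => //; split=> // s' Ks' ?; apply: maxpq; exists s'.
all: have [[p' [q' [_ _ pq' sE]]] _] := Ks'; rewrite {}sE in Ks' lts'.
all: have dlt := box_dim_lt pq pq' lts'.
all: have := max_card [set i | p' 0 i != q' 0 i]%SET.
all: rewrite card_ord -/(box_dim p' q').
  (* In codimension 0 a strictly larger cube would have dimension above [n]. *)
  by move=> dn; move: dimk; rewrite leqn0 subn_eq0 leqNgt (leq_trans dlt).
move=> dn; have [|s'' Ks'' subs''] := IHk _ _ _ pq' Ks'.
  rewrite -ltnS; apply: leq_trans dimk; apply: ltn_sub2l => //.
  exact: leq_trans dn.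
by exists s'' => //; apply: subset_trans subs''; case: lts'.
Qed.

(** * Past links and convexity of their realizations *)

Lemma past_link_cube K v S :
  integral_point v -> past_link K 0 v S -> cubes K (box (v - indicator R S) v).
Proof.
move=> vZ lkS; split; last by move=> x /lkS [].
exists (v - indicator R S), v; split=> // i; rewrite !mxE.
  by rewrite rpredB ?vZ //; case: (i \in S); rewrite ?rpred0 ?rpred1.
by rewrite opprB addrCA subrr addr0; case: (i \in S); [right|left].
Qed.

Lemma past_link_box_mem v (S : {set 'I_n}) :
  box (v - indicator R S) v (v - indicator R S).
Proof. by split=> // i; rewrite !mxE gerBl ler0n. Qed.

(* All the cubes below [v] lie in [box p q], so the past link is a simplex. *)
Lemma past_link_setU K v s S S' :
  maximal_cube K s -> integral_point v ->
  (forall s', maximal_cube K s' -> s' v -> s' = s) ->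
  past_link K 0 v S -> past_link K 0 v S' -> past_link K 0 v (S :|: S')%SET.
Proof.
move=> [[[p [q [_ _ _ sE]]] sK] _] vZ uniqs.
(* The cube spanned by [T] below [v] extends to a maximal cube; that cube contains [v], so it is
   [s]. The bounds are read off at the two corners. *)
have lkP T : past_link K 0 v T ->
    [/\ preceq p (v - indicator R T), preceq 0 (v - indicator R T) & preceq v q].
  move=> lkT; have [s' maxs' subs'] := sub_maximal_cube (past_link_cube vZ lkT).
  have vT : box (v - indicator R T) v v.
    by split=> //; case: (past_link_box_mem v T).
  have s's := uniqs _ maxs' (subs' _ vT); rewrite s's sE in subs'.
  have [? _] := subs' _ (past_link_box_mem v T); have [_ ?] := subs' _ vT.
  by have [_ []] := lkT _ (past_link_box_mem v T).
move=> /lkP[pS zS vq] /lkP[pS' zS' _].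
(* Each coordinate of the corner for the union equals that of the corner for [S] or for [S'], so
   common lower bounds persist. *)
have below w : preceq w (v - indicator R S) -> preceq w (v - indicator R S') ->
    preceq w (v - indicator R (S :|: S')%SET).
  move=> wS wS' i; have := wS i; have := wS' i; rewrite !mxE inE.
  by case: (i \in S) => //; case: (i \in S').
move=> x xv; split.
  by apply: sK; rewrite sE; apply: box_subset xv => //; exact: below.
by apply: box_subset xv => //; exact: below.
Qed.

(** The support of a convex combination lies in the union of the two supports, hence is a face of a
    simplex of [X]. *)
Lemma realization_convex (X : set {set 'I_n}) :
  (forall S S' : {set 'I_n}, S' \subset S -> X S -> X S') ->
  (forall S S', X S -> X S' -> X (S :|: S')%SET) ->
  forall (x y : 'rV[R]_n) t, realization X x -> realization X y -> 0 <= t <= 1 ->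
  realization X ((1 - t) *: x + t *: y).
Proof.
move=> faceX unionX x y t [x0 x1 Xx] [y0 y1 Xy] /andP[t0 t1]; split.
- move=> i; rewrite !mxE addr_ge0 // mulr_ge0 //; lra.
- under eq_bigr do rewrite !mxE.
  by rewrite big_split /= -!mulr_sumr x1 y1; lra.
- apply: faceX (unionX _ _ Xx Xy); apply/fintype.subsetP => i; rewrite !inE !mxE.
  apply: contraNT; rewrite negb_or !negbK => /andP[/eqP -> /eqP ->].
  by rewrite !mulr0 addr0.
Qed.

(** * Effect of one directed collapse *)

Lemma directed_collapse_vertices K K' v :
  directed_collapse K K' -> vertices K' v -> vertices K v.
Proof.
move=> [_ _ _ [s [t [_ _ _ _ cubesE]]] _] [vZ K'v]; split=> //.
have : cubes K' [set v] by split; [exact: elementary_cube1|move=> _ ->].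
by rewrite cubesE => -[[_ ] + _]; apply.
Qed.

(** The cube [[set v]] is deleted, so it contains [t]. A maximal cube through [v] then contains [t],
    and uniqueness over [t] becomes uniqueness over [v]. *)
Lemma collapsed_past_link_convex K K' v :
  directed_collapse K K' -> vertices K v -> ~ vertices K' v ->
  forall (x y : 'rV[R]_n) t, realization (past_link K 0 v) x ->
  realization (past_link K 0 v) y -> 0 <= t <= 1 ->
  realization (past_link K 0 v) ((1 - t) *: x + t *: y).
Proof.
move=> [_ _ _ [s [t [[_ [tcube _]] _ maxs uniqs cubesE]]] _] [vZ Kv] K'v.
have tv : t `<=` [set v].
  have Kv1 : cubes K [set v] by split; [exact: elementary_cube1|move=> _ ->].
  apply: contrapT => ntv; apply: K'v; split=> //.
  have : cubes K' [set v] by rewrite cubesE; split=> // -[].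
  by case=> _; apply.
apply: realization_convex => [S S'|S S']; first exact: past_link_face.
by apply: (past_link_setU maxs vZ) => s' maxs' s'v; apply: uniqs => // x /tv ->.
Qed.

(** Abstracting the obstruction to a homotopy-invariant [bad] treats both types at once. The empty
    set needs its own hypothesis, since it is not contractible. *)
Lemma directed_collapse_obstruction (bad : set 'rV[R]_n -> Prop) K K' :
  (forall A B : set 'rV[R]_n, homotopy_equivalent R A B -> bad A -> bad B) ->
  (forall A : set 'rV[R]_n, contractible R A -> ~ bad A) -> ~ bad set0 ->
  directed_collapse K K' ->
  (forall v, ~ (vertices K v /\ bad (realization (past_link K 0 v)))) <->
  (forall v, ~ (vertices K' v /\ bad (realization (past_link K' 0 v)))).
Proof.
move=> badE badNc badN0 KK'; have [_ _ _ _ lkE] := KK'.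
split=> noobs v [Kv badv].
  apply: (noobs v); split; first exact: directed_collapse_vertices Kv.
  exact: badE (homotopy_equivalent_sym (lkE v Kv)) badv.
have [K'v|K'v] := pselect (vertices K' v).
  by apply: (noobs v); split=> //; exact: badE (lkE v K'v) badv.
(* The realization is empty when the past link has no simplex but the empty one. *)
have [lk0|/set0P lkn0] := eqVneq (realization (R := R) (past_link K 0 v)) set0.
  by apply: badN0; rewrite -lk0.
apply: badNc badv; apply: convex_contractible lkn0.
exact: collapsed_past_link_convex KK' Kv K'v.
Qed.

End PastLinks.

Theorem corollary2 (R : realType) (n : nat) (K K' : set 'rV[R]_n)
    (m : nat) (Ks : nat -> set 'rV[R]_n)
    (K_complex : euclidean_cubical_complex K)
    (K_initial : vertices K 0)
    (Ks_first : Ks 0%N = K) (Ks_last : Ks m = K')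
    (Ks_collapse : forall i, (i < m)%N ->
       directed_collapse (Ks i) (Ks i.+1)) :
  ((forall v, ~ obstruction_infty K 0 v) <->
   (forall v, ~ obstruction_infty K' 0 v)) /\
  ((forall v, ~ obstruction_zero K 0 v) <->
   (forall v, ~ obstruction_zero K' 0 v)).
Proof.
have chain (bad : set 'rV[R]_n -> Prop) :
    (forall A B : set 'rV[R]_n, homotopy_equivalent R A B -> bad A -> bad B) ->
    (forall A : set 'rV[R]_n, contractible R A -> ~ bad A) -> ~ bad set0 ->
    (forall v, ~ (vertices K v /\ bad (realization (past_link K 0 v)))) <->
    (forall v, ~ (vertices K' v /\ bad (realization (past_link K' 0 v)))).
  move=> badE badNc badN0; rewrite -Ks_first -Ks_last.
  (* The last collapse is split off: the induction hypothesis compares [Ks 0] with [Ks k], and the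
     one-step lemma compares [Ks k] with [Ks k.+1]. *)
  elim: m Ks_collapse {Ks_last} => [//|k IHk] collapse.
  have := directed_collapse_obstruction badE badNc badN0 (collapse k (ltnSn k)).
  by apply: iff_trans; apply: IHk => i /ltnW; exact: collapse.
split; last first.
  (* [obstruction_zero] unfolds to exactly the shape handled by [chain]. *)
  apply: (chain (fun A => ~ connected A)) => [A B AB nA Bc|A Ac|].
  - apply: nA.
    exact: homotopy_equivalent_connected (homotopy_equivalent_sym AB) Bc.
  - by apply; exact: contractible_connected Ac.
  - by apply; exact: connected0.
(* The triple conjunction is regrouped so that nonemptiness and non-contractibility together form
   [bad]. *)
have inftyE (L : set 'rV[R]_n) v : obstruction_infty L 0 v <->
    let lk := realization (R := R) (past_link L 0 v) in
    vertices L v /\ (lk !=set0 /\ ~ contractible R lk).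
  by split=> [[]|[? []]].
have [] := chain (fun A => A !=set0 /\ ~ contractible R A).
- move=> A B AB [A0 nA]; split; first exact: homotopy_equivalent_nonempty AB A0.
  move=> Bc; apply: nA.
  exact: homotopy_equivalent_contractible (homotopy_equivalent_sym AB) Bc.
- by move=> A Ac [].
- by move=> [[]].
by move=> KK' K'K; split=> h v /inftyE;
  [apply: KK' => w /inftyE|apply: K'K => w /inftyE];
  exact: h.
Qed.
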